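(* Let $M$ be a positive integer, and let $U^n\in\mathbb{R}^N$, $Q_1^n,Q_2^n\in\mathbb{R}$, $n=0,1,\dots,M$, satisfy the initial conditions $$U_j^0=u_0(x_j),\quad Q_1^0=\sqrt{\langle g(U^0,D_1U^0),\mathbf{1}\rangle_h+C_1},\quad Q_2^0=\sqrt{\langle h(U^0,D_1U^0),\mathbf{1}\rangle_h+C_2},$$ and, for every $n=0,1,\dots,M-1$, the scheme $$\begin{aligned} &\delta_tU^n=D\Big(-\mathcal{G}_1(W^n)\,Q_1^{n+\frac12}+\mathcal{G}_2(W^n)\,Q_2^{n+\frac12}+\tfrac14\big(U^{n+\frac12}-D_2U^{n+\frac12}\big)\Big),\\ &\delta_tQ_1^n=\big\langle\mathcal{G}_1(W^n),\delta_tU^n\big\rangle_h,\\ &\delta_tQ_2^n=\big\langle\mathcal{G}_2(W^n),\delta_tU^n\big\rangle_h, \end{aligned}$$ where $W^n=\hat U^{n+\frac12}=\frac{3U^n-U^{n-1}}{2}$ for $n=1,\dots,M-1$, $W^0=U^0$, and $$\mathcal{G}_1(W)=\frac{g_1(W,D_1W)-D_1g_2(W,D_1W)}{2\sqrt{\langle g(W,D_1W),\mathbf{1}\rangle_h+C_1}},\qquad \mathcal{G}_2(W)=\frac{h_1(W,D_1W)-D_1h_2(W,D_1W)}{2\sqrt{\langle h(W,D_1W),\mathbf{1}\rangle_h+C_2}} .$$ Then the discrete modified energy $$E_h^n=\frac18\langle U^n-D_2U^n,U^n\rangle_h-\frac12(Q_1^n)^2+\frac12(Q_2^n)^2+\frac12C_1-\frac12C_2$$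 satisfies $E_h^{n+1}=E_h^n$ for $n=0,1,\dots,M-1$.
   Context: Let $a<b$, $L=b-a$, $\mu=2\pi/L$, $N$ an even positive integer, $\Delta x=L/N$, $x_j=j\,\Delta x$, $T>0$, time step $\tau=T/M$. The function $u_0:\mathbb{R}\to\mathbb{R}$ is $L$-periodic. Vectors in $\mathbb{R}^N$ are indexed by $j=0,\dots,N-1$; $\mathbf{1}=(1,\dots,1)^T\in\mathbb{R}^N$; $\langle U,V\rangle_h=\Delta x\sum_{j=0}^{N-1}U_jV_j$ (the subscript $h$ is only a label referring to the mesh size). For any sequence $(V^n)$ of vectors or scalars, $$\delta_tV^n=\frac{V^{n+1}-V^n}{\tau},\qquad V^{n+\frac12}=\frac{V^{n+1}+V^n}{2}.$$ The Fourier pseudo-spectral differentiation matrices $D_1,D_2\in\mathbb{R}^{N\times N}$ are $$(D_1)_{j,l}=\begin{cases}\frac12\mu(-1)^{j+l}\cot\big(\mu\frac{x_j-x_l}{2}\big),&j\ne l,\\0,&j=l,\end{cases}\qquad (D_2)_{j,l}=\begin{cases}\frac12\mu^2(-1)^{j+l+1}\csc^2\big(\mu\frac{x_j-x_l}{2}\big),&j\neq l,\\-\mu^2\frac{N^2+2}{12},&j=l.\end{cases}$$ Equivalently, $D_k=F_N^H\Lambda_kF_N$ with $(F_N)_{j,k}=\frac1{\sqrt N}e^{-\mathrm{i}jk2\pi/N}$, $\Lambda_1=\mathrm{i}\mu\,\mathrm{diag}[0,1,\dots,\frac N2-1,0,1-\frac N2,\dots,-1]$, $\Lambda_2=-\mu^2\,\mathrm{diag}[0^2,1^2,\dots,(\frac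 N2)^2,(-\frac N2+1)^2,\dots,(-1)^2]$. Set $D=(I-D_2)^{-1}D_1$, with $I$ the identity matrix. The scalar functions, applied componentwise to pairs of vectors, are $$g(u,v)=(u+\tfrac12)^2(u^2+v^2),\quad g_1(u,v)=\tfrac{\partial g}{\partial u}=2(u+\tfrac12)(2u^2+v^2+\tfrac12u),\quad g_2(u,v)=\tfrac{\partial g}{\partial v}=2v(u+\tfrac12)^2,$$ $$h(u,v)=u^2(u^2+v^2),\quad h_1(u,v)=\tfrac{\partial h}{\partial u}=4u^3+2uv^2,\quad h_2(u,v)=\tfrac{\partial h}{\partial v}=2vu^2.$$ $C_1,C_2$ are real constants large enough that all quantities under the square roots in the scheme are positive. *)

(* Defs.v *)
(* MathComp-Analysis, over an arbitrary real field [R : realType]. *)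
From HB Require Import structures.
From mathcomp Require Import all_boot all_order all_algebra.
From mathcomp Require Import all_classical all_reals all_analysis.
From mathcomp Require Import ring.

Set Implicit Arguments.
Unset Strict Implicit.
Unset Printing Implicit Defensive.

Import Order.TTheory GRing.Theory Num.Theory.
Import numFieldNormedType.Exports.

Local Open Scope ring_scope.

(* [V] is a space of vectors or [R] itself, as a module over itself. *)
Section TimeDifferences.
Variables (R : realType) (V : lmodType R).

Definition dt (tau : R) (v : nat -> V) (n : nat) : V :=
  tau^-1 *: (v n.+1 - v n).

Definition midavg (v : nat -> V) (n : nat) : V := 2^-1 *: (v n.+1 + v n).

(* The argument \hat V^{n+1/2} of the nonlinear terms; the first step, which
   has no predecessor, uses V^0 instead. *)
Definition extrap (v : nat -> V) (n : nat) : V :=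
  if n is m.+1 then 2^-1 *: (3 *: v m.+1 - v m) else v 0%N.

End TimeDifferences.

Section ScalarFunctions.
Variable R : realType.
Implicit Types u v : R.

Definition cot (x : R) : R := cos x / sin x.
Definition csc (x : R) : R := (sin x)^-1.

Definition g u v : R := (u + 1 / 2) ^+ 2 * (u ^+ 2 + v ^+ 2).
Definition g1 u v : R := 2 * (u + 1 / 2) * (2 * u ^+ 2 + v ^+ 2 + 1 / 2 * u).
Definition g2 u v : R := 2 * v * (u + 1 / 2) ^+ 2.

Definition h u v : R := u ^+ 2 * (u ^+ 2 + v ^+ 2).
Definition h1 u v : R := 4 * u ^+ 3 + 2 * u * v ^+ 2.
Definition h2 u v : R := 2 * v * u ^+ 2.

Lemma is_derive_g1 u v : is_derive u 1 (g^~ v) (g1 u v).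
Proof.
rewrite /g; apply: is_derive_eq.
by rewrite /g1 /GRing.scale /=; field.
Qed.

Lemma is_derive_g2 u v : is_derive v 1 (g u) (g2 u v).
Proof.
rewrite /g; apply: is_derive_eq.
by rewrite /g2 /GRing.scale /=; field.
Qed.

Lemma is_derive_h1 u v : is_derive u 1 (h^~ v) (h1 u v).
Proof.
rewrite /h; apply: is_derive_eq.
by rewrite /h1 /GRing.scale /=; ring.
Qed.

Lemma is_derive_h2 u v : is_derive v 1 (h u) (h2 u v).
Proof.
rewrite /h; apply: is_derive_eq.
by rewrite /h2 /GRing.scale /=; ring.
Qed.

End ScalarFunctions.

(* [L] is the period, [N] the number of grid points. *)
Section Discretization.
Variables (R : realType) (L : R) (N : nat).
Implicit Types (U V W : 'cV[R]_N) (C : R).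

Definition mu : R := 2 * pi / L.
Definition dx : R := L / N%:R.
Definition grid (j : nat) : R := j%:R * dx.

Definition inner U V : R := dx * \sum_(j < N) U j 0 * V j 0.

Definition D1 : 'M[R]_N := \matrix_(j, l)
  if j == l then 0
  else 1 / 2 * mu * (-1) ^+ (j + l) * cot (mu * ((grid j - grid l) / 2)).

Definition D2 : 'M[R]_N := \matrix_(j, l)
  if j == l then - (mu ^+ 2 * ((N%:R ^+ 2 + 2) / 12))
  else 1 / 2 * mu ^+ 2 * (-1) ^+ (j + l + 1)
       * csc (mu * ((grid j - grid l) / 2)) ^+ 2.

(* [invmx] is the inverse only of an invertible matrix; 1 - D2 is one for
   0 < L and N even and positive, since D2 is then negative semidefinite. *)
Definition Dop : 'M[R]_N := invmx (1%:M - D2) *m D1.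

(* The componentwise f(W, D1 W). *)
Definition onD1 (f : R -> R -> R) W : 'cV[R]_N := map2_mx f W (D1 *m W).

(* The radicand <f(W, D1 W), 1>_h + C. *)
Definition radicand (f : R -> R -> R) C W : R := inner (onD1 f W) (const_mx 1) + C.

Definition G1 C W : 'cV[R]_N :=
  (2 * Num.sqrt (radicand (@g R) C W))^-1 *:
  (onD1 (@g1 R) W - D1 *m onD1 (@g2 R) W).

Definition G2 C W : 'cV[R]_N :=
  (2 * Num.sqrt (radicand (@h R) C W))^-1 *:
  (onD1 (@h1 R) W - D1 *m onD1 (@h2 R) W).

Definition energy C1 C2 (U : nat -> 'cV[R]_N) (Q1 Q2 : nat -> R) (n : nat) : R :=
  1 / 8 * inner (U n - D2 *m U n) (U n) - 1 / 2 * Q1 n ^+ 2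
  + 1 / 2 * Q2 n ^+ 2 + 1 / 2 * C1 - 1 / 2 * C2.

End Discretization.

(* Main.v *)
(* The matrices D1 and D2 are circulant, hence commute; D1 is antisymmetric and
   D2 is symmetric, so D = (1 - D2)^-1 D1 is antisymmetric.  Writing the scheme
   as dt U = D F, this gives <F, dt U> = 0, and tau <F, dt U> is the energy
   increment: -Q1^(n+1/2) <G1, dt U> and Q2^(n+1/2) <G2, dt U> are difference
   quotients of -Q1^2/2 and Q2^2/2, and 1/4 <(1 - D2) U^(n+1/2), dt U> is one of
   the quadratic part because 1 - D2 is symmetric. *)
Require Import Defs.
From HB Require Import structures.
From mathcomp Require Import all_boot all_order all_algebra.
From mathcomp Require Import all_classical all_reals all_analysis.
From mathcomp Require Import ring.

Set Implicit Arguments.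
Unset Strict Implicit.
Unset Printing Implicit Defensive.

Import Order.TTheory GRing.Theory Num.Theory.
Import numFieldNormedType.Exports.

Local Open Scope ring_scope.

(** Indices are subtracted modulo [n.+1]. The substitution [k -> i + l - k] in the sum for the entry
    [(i, l)] exchanges the differences [i - k] and [k - l], hence the two factors. *)
Lemma circulant_comm (R : comPzRingType) (n : nat) (A B : 'M[R]_n.+1) :
  (forall i j, A i j = A (i - j) 0) -> (forall i j, B i j = B (i - j) 0) ->
  A *m B = B *m A.
Proof.
move=> cA cB; apply/matrixP => i l; rewrite !mxE.
rewrite (reindex_inj (inv_inj (fun k => subKr (i + l) k))) /=.
apply: eq_bigr => k _.
rewrite [A i _]cA [B _ l]cB [A k l]cA [B i k]cB mulrC.
congr (B _ _ * A _ _); first by rewrite addrAC addrK.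
by rewrite opprB opprD addrCA addNKr.
Qed.

(** The bit [b] is the carry of the modular subtraction: it is set exactly when [i < j]. *)
Lemma ord_subE (n : nat) (i j : 'I_n.+1) :
  exists b : bool, ((i - j)%R + j = i + b * n.+1)%N.
Proof.
exists (i < j)%N; rewrite /= modnDmr.
have lti := ltn_ord i; have ltj := ltn_ord j.
case: ltnP => ij.
  rewrite modn_small; first by rewrite mul1n -addnA subnK // ltnW.
  by rewrite -[ltnRHS](subnKC (ltnW ltj)) ltn_add2r.
rewrite addnBA ?(ltnW ltj)// [(i + _)%N]addnC -addnBA// modnDl.
rewrite modn_small ?subnK ?addn0//.
by rewrite (leq_ltn_trans (leq_subr _ _)).
Qed.

Section Trigonometry.
Variable R : realType.
Implicit Types x : R.

Lemma cotN x : cot (- x) = - cot x.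
Proof. by rewrite /cot sinN cosN invrN mulrN. Qed.

Lemma cotDpi x : cot (x + pi) = cot x.
Proof. by rewrite /cot sinDpi cosDpi invrN mulrNN. Qed.

Lemma sqr_cscN x : csc (- x) ^+ 2 = csc x ^+ 2.
Proof. by rewrite /csc sinN invrN sqrrN. Qed.

(** The square matters: [csc] itself changes sign under a shift by [pi]. *)
Lemma sqr_cscDpi x : csc (x + pi) ^+ 2 = csc x ^+ 2.
Proof. by rewrite /csc sinDpi invrN sqrrN. Qed.

End Trigonometry.

Section DifferentiationMatrices.
Variables (R : realType) (L : R).

Lemma half_diffC (c x y : R) : c * ((x - y) / 2) = - (c * ((y - x) / 2)).
Proof. by ring. Qed.

Lemma D1_tr N : (D1 L N)^T = - D1 L N.
Proof.
apply/matrixP => i j; rewrite !mxE eq_sym; case: eqP => _; first by rewrite oppr0.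
by rewrite addnC half_diffC cotN mulrN.
Qed.

Lemma D2_tr N : (D2 L N)^T = D2 L N.
Proof.
apply/matrixP => i j; rewrite !mxE eq_sym; case: eqP => // _.
by rewrite half_diffC sqr_cscN [(j + i)%N]addnC.
Qed.

Hypothesis L_neq0 : L != 0.
Variable n : nat.
Hypothesis n_odd : odd n.

(** A wrap-around moves the grid point by one period [L], and [mu L * (L / 2) = pi]. Entries that
    are [pi]-periodic in the half phase therefore depend only on [i - j]. *)
Lemma half_phase_sub (i j : 'I_n.+1) : exists b : bool,
  mu L * ((grid L n.+1 (i - j)%R - grid L n.+1 0) / 2)
  = mu L * ((grid L n.+1 i - grid L n.+1 j) / 2) + pi *+ b.
Proof.
have [b /(congr1 (fun k => k%:R : R))] := ord_subE i j.
rewrite !natrD natrM => /eqP; rewrite -subr_eq0 => /eqP e; exists b.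
have n0 : n.+1%:R != 0 :> R by rewrite pnatr_eq0.
rewrite -mulr_natl /mu /grid /dx mul0r subr0.
have -> : (i - j)%R%:R = i%:R + b%:R * n.+1%:R - j%:R :> R.
  by rewrite -[LHS](addrK (j%:R : R)); apply/eqP; rewrite -subr_eq0 -e; apply/eqP; ring.
by field; rewrite addrC natr1 n0.
Qed.

(** The number of grid points [n.+1] is even, so a wrap-around keeps the parity of the index. *)
Lemma signr_sub (i j : 'I_n.+1) :
  (-1) ^+ ((i - j)%R + 0%R)%N = (-1) ^+ (i + j) :> R.
Proof.
have [b /(congr1 odd)] := ord_subE i j.
rewrite !oddD oddM /= n_odd andbF addbF => e.
by rewrite addn0 -[LHS]signr_odd -[RHS]signr_odd oddD -e -addbA addbb addbF.
Qed.

Lemma D1_circulant (i j : 'I_n.+1) : D1 L n.+1 i j = D1 L n.+1 (i - j) 0.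
Proof.
rewrite [LHS]mxE [RHS]mxE subr_eq0; case: eqP => // _.
rewrite signr_sub; have [[] ->] := half_phase_sub i j.
  by rewrite mulr1n cotDpi.
by rewrite mulr0n addr0.
Qed.

Lemma D2_circulant (i j : 'I_n.+1) : D2 L n.+1 i j = D2 L n.+1 (i - j) 0.
Proof.
rewrite [LHS]mxE [RHS]mxE subr_eq0; case: eqP => // _.
rewrite !(exprD _ _ 1) signr_sub; have [[] ->] := half_phase_sub i j.
  by rewrite mulr1n sqr_cscDpi.
by rewrite mulr0n addr0.
Qed.

(* Invertibility of 1 - D2 plays no role: for a singular matrix invmx is the
   identity, and D1 commutes with 1 - D2 itself as well. *)
Lemma Dop_tr : (Dop L n.+1)^T = - Dop L n.+1.
Proof.
rewrite /Dop trmx_mul trmx_inv linearB /= trmx1 D1_tr D2_tr mulNmx.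
(* Transposition has reversed the factors; it remains to commute [D1] with the inverse of
   [1 - D2]. *)
congr (- _).
have c : GRing.comm (D1 L n.+1) (1%:M - D2 L n.+1).
  apply: commrB; first exact: commr1.
  exact: circulant_comm D1_circulant D2_circulant.
exact: commrV c.
Qed.

End DifferentiationMatrices.

Section InnerProduct.
Variables (R : realType) (L : R) (N : nat).
Implicit Types (U V W : 'cV[R]_N) (A : 'M[R]_N) (c : R).

Lemma innerE U V : inner L U V = dx L N * (U^T *m V) 0 0.
Proof. by rewrite /inner mxE; congr (_ * _); apply: eq_bigr => i _; rewrite mxE. Qed.

Lemma innerC U V : inner L U V = inner L V U.
Proof. by rewrite /inner; congr (_ * _); apply: eq_bigr => i _; rewrite mulrC. Qed.

Lemma innerDl U V W : inner L (U + V) W = inner L U W + inner L V W.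
Proof. by rewrite !innerE linearD /= mulmxDl mxE mulrDr. Qed.

Lemma innerZl c U V : inner L (c *: U) V = c * inner L U V.
Proof. by rewrite !innerE linearZ /= -scalemxAl mxE mulrCA. Qed.

Lemma innerNl U V : inner L (- U) V = - inner L U V.
Proof. by rewrite -scaleN1r innerZl mulN1r. Qed.

Lemma innerBr U V W : inner L U (V - W) = inner L U V - inner L U W.
Proof. by rewrite !(innerC U) innerDl innerNl. Qed.

Lemma innerZr c U V : inner L U (c *: V) = c * inner L U V.
Proof. by rewrite !(innerC U) innerZl. Qed.

Lemma inner_mulmxl A U V : inner L (A *m U) V = inner L U (A^T *m V).
Proof. by rewrite !innerE trmx_mul mulmxA. Qed.

(** Moving [A] to the other argument shows that the number equals its own opposite. *)
Lemma inner_antisym A U : A^T = - A -> inner L U (A *m U) = 0.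
Proof.
move=> tA; have := inner_mulmxl A U U.
rewrite tA mulNmx innerC (innerC _ (- _)) innerNl (innerC _ U) => /eqP.
by rewrite -addr_eq0 -mulr2n mulrn_eq0 => /eqP.
Qed.

End InnerProduct.

Theorem theorem4p1 (R : realType) (a b : R) (N : nat) (T : R) (M : nat)
    (u0 : R -> R) (C1 C2 : R)
    (U : nat -> 'cV[R]_N) (Q1 Q2 : nat -> R) :
  let L := b - a in
  let tau := T / M%:R in
  let W := extrap U in
  a < b -> (0 < N)%N -> ~~ odd N -> 0 < T -> (0 < M)%N ->
  (forall x, u0 (x + L) = u0 x) ->
  (forall n, (n < M)%N -> 0 < radicand L (@g R) C1 (W n)) ->
  (forall n, (n < M)%N -> 0 < radicand L (@h R) C2 (W n)) ->
  (forall j : 'I_N, U 0%N j 0 = u0 (grid L N j)) ->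
  Q1 0%N = Num.sqrt (radicand L (@g R) C1 (U 0%N)) ->
  Q2 0%N = Num.sqrt (radicand L (@h R) C2 (U 0%N)) ->
  (forall n, (n < M)%N ->
     dt tau U n =
       Dop L N *m (- (midavg Q1 n *: G1 L C1 (W n)) + midavg Q2 n *: G2 L C2 (W n)
                   + (1 / 4) *: (midavg U n - D2 L N *m midavg U n))) ->
  (forall n, (n < M)%N -> dt tau Q1 n = inner L (G1 L C1 (W n)) (dt tau U n)) ->
  (forall n, (n < M)%N -> dt tau Q2 n = inner L (G2 L C2 (W n)) (dt tau U n)) ->
  forall n, (n < M)%N ->
    energy L C1 C2 U Q1 Q2 n.+1 = energy L C1 C2 U Q1 Q2 n.
Proof.
move=> L tau W lt_ab N_gt0 N_even T_gt0 M_gt0 _ _ _ _ _ _ eqU eqQ1 eqQ2 n ltnM.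
have L0 : L != 0 by rewrite subr_eq0 gt_eqF.
have tau0 : tau != 0 by rewrite mulf_neq0 ?invr_eq0 ?pnatr_eq0 -?lt0n// gt_eqF.
have tD : (Dop L N)^T = - Dop L N.
  (* Modular index arithmetic needs a size of the form [m.+1]; evenness of [N] becomes oddness of
     [m]. *)
  by case: N N_gt0 N_even {U W eqU eqQ1 eqQ2} => // m _ /negPn; exact: Dop_tr.
have := inner_antisym L (- (midavg Q1 n *: G1 L C1 (W n))
  + midavg Q2 n *: G2 L C2 (W n)
  + (1 / 4) *: (midavg U n - D2 L N *m midavg U n)) tD.
(* The scheme, read backwards, turns [D F] into [dt tau U n] and the products with [G1] and [G2]
   into [dt tau Q1 n] and [dt tau Q2 n]. *)
rewrite -eqU // !innerDl innerNl innerZl -eqQ1 // innerZl -eqQ2 // innerZl.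
pose A := 1%:M - D2 L N.
have AE V : V - D2 L N *m V = A *m V by rewrite mulmxBl mul1mx.
have tA : A^T = A by rewrite linearB /= trmx1 D2_tr.
(* With this the mixed terms of the product of [A *m (U n.+1 + U n)] with [U n.+1 - U n] cancel. *)
have sA : inner L (A *m U n) (U n.+1) = inner L (A *m U n.+1) (U n).
  by rewrite inner_mulmxl tA innerC.
rewrite /energy !AE /dt /midavg -scalemxAr mulmxDr.
rewrite innerZl innerZr innerDl !innerBr sA /GRing.scale /= => e.
(* Writing 0 as [tau * 0] and replacing it through [e] leaves an identity between scalars, where
   [tau] cancels the denominators of the difference quotients. *)
apply/eqP; rewrite -subr_eq0 -(mulr0 tau) -e; apply/eqP.
by field.
Qed.
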